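(* Let $\kappa, m\ge 1$ be integers. There exists a routing strategy for the directed graph $\mathcal{B}_{clockwise}(\kappa,m)$ in which routes take $2m-1$ hops in the worst-case. The average is at most $1.5m$ hops.
   Context: The $n$ nodes lie on a ring and are labeled $0,1,\dots,n-1$ according to their order on the ring; $x \bmod n$ always denotes an element of $[0,n-1]$, even when $x$ is negative or greater than $n-1$. Graph $\mathcal{B}_{clockwise}(\kappa,m)$ (defined for integers $\kappa,m\ge 1$): it has $n=\kappa^m m$ nodes. For a node $u$ let $\ell(u)=(m-1)-(u \bmod m)$. Each node has $\kappa$ links; for node $u$ these directed links are to the nodes $(u+x)\bmod n$, where $x\in\{1+i m\kappa^{\ell(u)} : i\in[0,\kappa-1]\}$ ($i$ an integer). A routing strategy specifies how a message travels from a source node to a target node along directed links of the graph (it need not be greedy); the number of hops of a route is the number of links traversed. *)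

(* Defs.v *)
(* MathComp world. *)
From mathcomp Require Import all_boot all_order all_algebra.

Set Implicit Arguments.
Unset Strict Implicit.
Unset Printing Implicit Defensive.

Definition bcw_size (kappa m : nat) : nat := kappa ^ m * m.

Definition bcw_node (kappa m : nat) : finType := 'I_(bcw_size kappa m).

(* For m >= 1 we have u %% m <= m - 1, so the subtraction never truncates. *)
Definition bcw_ell (m u : nat) : nat := (m - 1) - u %% m.

Definition bcw_link (kappa m : nat) : rel (bcw_node kappa m) :=
  fun u v => [exists i : 'I_kappa,
    (v : nat) == (u + (1 + i * m * kappa ^ bcw_ell m u)) %% bcw_size kappa m].

(* A route from s to t is the list of nodes visited after s: a directed walk,
   which need not be shortest, greedy or simple, and for s = t may be empty or
   a closed walk. *)
Record routing (T : finType) (e : rel T) := Routing {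
  route : T -> T -> seq T;
  route_path : forall s t, path e s (route s t);
  route_last : forall s t, last s (route s t) = t
}.

Definition hops (T : finType) (e : rel T) (r : routing e) (s t : T) : nat :=
  size (route r s t).

Definition worst_case_hops (T : finType) (e : rel T) (r : routing e) : nat :=
  \max_(s : T) \max_(t : T) hops r s t.

(* Source and target are independent and uniform over the nodes. *)
Definition average_hops (T : finType) (e : rel T) (r : routing e) : rat :=
  ((\sum_(s : T) \sum_(t : T) hops r s t)%N%:R / (#|T| ^ 2)%N%:R)%R.

(* Main.v *)
(** Every link raises the residue of the current node modulo [m] by one, so [m]
    consecutive hops use each of the levels [0, ..., m - 1] exactly once.
    Choosing at level [l] the base-[kappa] digit of [q] of weight [kappa ^ l],
    these hops move the message by [m + m * q] with [q] arbitrary modulo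
    [kappa ^ m], i.e. to any node in the residue class of the source. Then
    [r = (t - s) mod m] further unit hops reach the target [t], for [m + r] hops
    in all. The average is bounded by exchanging source and target, since
    [(t - s) mod m + (s - t) mod m <= m]. *)
Require Import Defs.
From mathcomp Require Import all_boot all_order all_algebra.
From mathcomp Require Import zify.

Lemma sum_digits (k q m : nat) : 0 < k ->
  \sum_(l < m) (q %/ k ^ l) %% k * k ^ l = q %% k ^ m.
Proof.
move=> k_gt0; elim: m => [|m IHm]; first by rewrite big_ord0 modn1.
rewrite big_ord_recr /= IHm modn_divl -expnS.
(* Both terms are now read off [q %% k ^ m.+1], as remainder and quotient of its division by
   [k ^ m]. *)
rewrite -[in LHS](@modn_dvdm (k ^ m.+1) q); last by rewrite expnS dvdn_mull.
by rewrite addnC -divn_eq.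
Qed.

(** Consecutive integers have distinct residues, so [h] is an injection of a finite type into itself
    and can serve as a reindexing. *)
Lemma sum_bcw_ell (m s : nat) (F : nat -> nat) : 0 < m ->
  \sum_(j < m) F (bcw_ell m (s + j)) = \sum_(l < m) F l.
Proof.
case: m => // m _.
have ell_lt j : bcw_ell m.+1 j < m.+1 by rewrite /bcw_ell; lia.
pose h (j : 'I_m.+1) : 'I_m.+1 := inord (bcw_ell m.+1 (s + j)).
have hE j : h j = bcw_ell m.+1 (s + j) :> nat by rewrite inordK.
have h_inj : injective h.
  move=> i j /(congr1 val) /=; rewrite !hE /bcw_ell => eq_ell.
  have lt_i := ltn_pmod (s + i) (ltn0Sn m).
  have lt_j := ltn_pmod (s + j) (ltn0Sn m).
  have : s + i == s + j %[mod m.+1] by apply/eqP; lia.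
  by rewrite eqn_modDl !modn_small // => /eqP /val_inj.
by rewrite [RHS](reindex_inj h_inj); apply: eq_bigr => j _; rewrite hE.
Qed.

Lemma bcw_size_gt0 (kappa m : nat) (u : bcw_node kappa m) : 0 < bcw_size kappa m.
Proof. exact: leq_ltn_trans (ltn_ord u). Qed.

Lemma bcw_ell_mod_size (kappa m x : nat) :
  bcw_ell m (x %% bcw_size kappa m) = bcw_ell m x.
Proof. by rewrite /bcw_ell modn_dvdm // dvdn_mull. Qed.

Lemma bcw_ellD (m x y : nat) : bcw_ell m (x + m * y) = bcw_ell m x.
Proof. by rewrite /bcw_ell addnC mulnC modnMDl. Qed.

Definition bcw_digit (kappa m q x : nat) : nat :=
  (q %/ kappa ^ bcw_ell m x) %% kappa.

(** With [q] fixed the hop depends on the current node alone, so each phase of a route is an orbit;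
    [q = 0] gives the unit hop. *)
Definition bcw_step (kappa m q : nat) (u : bcw_node kappa m) :
    bcw_node kappa m :=
  Ordinal (ltn_pmod (u + (1 + bcw_digit kappa m q u * m * kappa ^ bcw_ell m u))
                    (bcw_size_gt0 _ _ u)).

Lemma bcw_link_step (kappa m q : nat) (u : bcw_node kappa m) : 0 < kappa ->
  bcw_link u (bcw_step kappa m q u).
Proof.
move=> k_gt0; apply/existsP.
by exists (Ordinal (ltn_pmod (q %/ kappa ^ bcw_ell m u) k_gt0)) => /=.
Qed.

(** Levels may be read at [s + j] rather than at the node actually reached: the two differ by a
    multiple of [m], as [m] divides the size. *)
Lemma iter_bcw_step (kappa m q k : nat) (s : bcw_node kappa m) :
  iter k (bcw_step kappa m q) s =
  (s + k + m * \sum_(j < k) bcw_digit kappa m q (s + j) *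
                            kappa ^ bcw_ell m (s + j)) %% bcw_size kappa m :> nat.
Proof.
elim: k => [|k IHk] /=; first by rewrite big_ord0 muln0 !addn0 modn_small.
rewrite IHk /bcw_digit bcw_ell_mod_size bcw_ellD modnDml big_ord_recr /=.
congr (_ %% _); lia.
Qed.

Lemma iter_bcw_step_digits (kappa m q : nat) (s : bcw_node kappa m) :
  0 < kappa -> 0 < m ->
  iter m (bcw_step kappa m q) s =
  (s + m + m * (q %% kappa ^ m)) %% bcw_size kappa m :> nat.
Proof.
move=> k_gt0 m_gt0; rewrite iter_bcw_step -(sum_digits _ _ _ k_gt0).
by rewrite -(sum_bcw_ell _ s (fun l => q %/ kappa ^ l %% kappa * kappa ^ l)).
Qed.

Lemma iter_bcw_step0 (kappa m k : nat) (s : bcw_node kappa m) :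
  iter k (bcw_step kappa m 0) s = (s + k) %% bcw_size kappa m :> nat.
Proof.
rewrite iter_bcw_step big1 ?muln0 ?addn0 // => j _.
by rewrite /bcw_digit div0n mod0n.
Qed.

(** An unreduced representative of [t - s] modulo the size; the grouping avoids truncated
    subtraction. *)
Definition bcw_offset (kappa m s t : nat) : nat := t + (bcw_size kappa m - s).

(* Addition of [kappa ^ m - 1] is subtraction of one modulo [kappa ^ m]: it
   compensates for the [m] unit advances made while the digits are spelled. *)
Definition bcw_jump (kappa m s t : nat) : nat :=
  bcw_offset kappa m s t %/ m + (kappa ^ m - 1).

Definition bcw_route (kappa m : nat) (s t : bcw_node kappa m) :
    seq (bcw_node kappa m) :=
  let f := bcw_step kappa m (bcw_jump kappa m s t) in
  let g := bcw_step kappa m 0 in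
  traject f (f s) m ++ traject g (g (iter m f s)) (bcw_offset kappa m s t %% m).

Lemma size_bcw_route (kappa m : nat) (s t : bcw_node kappa m) :
  size (bcw_route kappa m s t) = m + bcw_offset kappa m s t %% m.
Proof. by rewrite size_cat !size_traject. Qed.

Lemma bcw_route_path (kappa m : nat) (s t : bcw_node kappa m) : 0 < kappa ->
  path (@bcw_link kappa m) s (bcw_route kappa m s t).
Proof.
move=> k_gt0.
have step_path q k (u : bcw_node kappa m) : path (@bcw_link kappa m) u
    (traject (bcw_step kappa m q) (bcw_step kappa m q u) k).
  apply: sub_path (fpath_traject (bcw_step kappa m q) u k) => v w /eqP <-.
  exact: bcw_link_step.
by rewrite cat_path last_traject !step_path.
Qed.

Lemma bcw_route_last (kappa m : nat) (s t : bcw_node kappa m) :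
  0 < kappa -> 0 < m -> last s (bcw_route kappa m s t) = t.
Proof.
move=> k_gt0 m_gt0; apply: val_inj => /=.
rewrite /bcw_route last_cat !last_traject iter_bcw_step0.
rewrite iter_bcw_step_digits // modnDml /bcw_jump.
set o := bcw_offset kappa m s t; have def_o := divn_eq o m.
have K_gt0 : 0 < kappa ^ m by rewrite expn_gt0 k_gt0.
rewrite muln_modr [m * kappa ^ m]mulnC -/(bcw_size kappa m).
rewrite addnAC modnDmr.
(* One copy of the size comes from the offset [o], the other from the summand [kappa ^ m - 1], whose
   [- 1] cancels the advance [m]. *)
have -> : s + m + o %% m + m * (o %/ m + (kappa ^ m - 1)) =
          t + 2 * bcw_size kappa m.
  have arith a r x y N : o = a + r -> m <= N -> x < N -> o = y + (N - x) ->
      x + m + r + (a + (N - m)) = y + 2 * N by lia.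
  rewrite mulnDr mulnBr muln1 [m * (o %/ m)]mulnC [m * kappa ^ m]mulnC.
  by apply: arith; rewrite ?leq_pmull ?ltn_ord.
by rewrite addnC modnMDl modn_small.
Qed.

Definition bcw_routing (kappa m : nat) (k_gt0 : 0 < kappa) (m_gt0 : 0 < m) :
    routing (@bcw_link kappa m) :=
  Routing (route := bcw_route kappa m)
    (fun s t => bcw_route_path kappa m s t k_gt0)
    (fun s t => bcw_route_last kappa m s t k_gt0 m_gt0).

(** The two offsets add up to twice the size, so the residues sum to a multiple of [m]; being below
    [2 * m], it is [0] or [m]. *)
Lemma bcw_offset_sym (kappa m : nat) (s t : bcw_node kappa m) : 0 < m ->
  bcw_offset kappa m s t %% m + bcw_offset kappa m t s %% m <= m.
Proof.
move=> m_gt0; set a := bcw_offset _ _ s t; set b := bcw_offset _ _ t s.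
have : m %| a %% m + b %% m.
  rewrite /dvdn modnDml modnDmr.
  have -> : a + b = 2 * kappa ^ m * m.
    have := ltn_ord s; have := ltn_ord t.
    rewrite /a /b /bcw_offset /bcw_size; lia.
  by rewrite modnMl.
case/dvdnP=> c def_c.
have c_lt2 : c < 2.
  rewrite -(ltn_pmul2r m_gt0) -def_c mul2n -addnn -addSn.
  by rewrite leq_add ?ltn_pmod // ltnW ?ltn_pmod.
by rewrite def_c -[leqRHS]mul1n leq_pmul2r.
Qed.

Lemma sum_bcw_offset (kappa m : nat) : 0 < m ->
  2 * (\sum_(s : bcw_node kappa m) \sum_(t : bcw_node kappa m)
        bcw_offset kappa m s t %% m) <= bcw_size kappa m ^ 2 * m.
Proof.
move=> m_gt0; rewrite mul2n -addnn {2}exchange_big -big_split /=.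
have -> : bcw_size kappa m ^ 2 * m =
    \sum_(s : bcw_node kappa m) \sum_(t : bcw_node kappa m) m.
  by rewrite !sum_nat_const card_ord expnS expn1 mulnA.
apply: leq_sum => s _; rewrite -big_split /=.
by apply: leq_sum => t _; apply: bcw_offset_sym.
Qed.

Theorem theorem3 (kappa m : nat) (kappa_ge1 : 1 <= kappa) (m_ge1 : 1 <= m) :
  exists r : routing (@bcw_link kappa m),
    worst_case_hops r = 2 * m - 1 /\
    (average_hops r <= 3%:R / 2%:R * m%:R)%R.
Proof.
pose r := bcw_routing kappa m kappa_ge1 m_ge1.
have hopsE s t : hops r s t = m + bcw_offset kappa m s t %% m.
  exact: size_bcw_route.
have le_m_size : m <= bcw_size kappa m by rewrite leq_pmull // expn_gt0 kappa_ge1.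
exists r; split.
  apply/eqP; rewrite eqn_leq; apply/andP; split.
    apply/bigmax_leqP => s _; apply/bigmax_leqP => t _; rewrite hopsE.
    by have := ltn_pmod (bcw_offset kappa m s t) m_ge1; lia.
  (* Source [0] and target [m - 1] attain the largest residue, [m - 1]. *)
  have lt0 : 0 < bcw_size kappa m by lia.
  have ltm : m - 1 < bcw_size kappa m by lia.
  apply: (bigmax_sup (Ordinal lt0)) => //.
  apply: (bigmax_sup (Ordinal ltm)) => //.
  rewrite hopsE /bcw_offset /bcw_size /= subn0 [m - 1 + _]addnC modnMDl.
  rewrite modn_small; lia.
rewrite /average_hops card_ord.
have N_gt0 : 0 < bcw_size kappa m ^ 2 by rewrite expn_gt0; lia.
(* The bound with denominators cleared: over all pairs, the doubled first phase gives [2 * m] per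
   pair and the doubled residues at most [m] on average. *)
have le_sum : 2 * (\sum_(s : bcw_node kappa m) \sum_(t : bcw_node kappa m)
    hops r s t) <= 3 * m * bcw_size kappa m ^ 2.
  under eq_bigr => s _ do under eq_bigr => t _ do rewrite hopsE.
  under eq_bigr => s _ do rewrite big_split /= sum_nat_const card_ord.
  rewrite big_split /= sum_nat_const card_ord mulnDr.
  have -> N : 3 * m * N ^ 2 = 2 * (N * (N * m)) + N ^ 2 * m.
    by lia.
  by rewrite leq_add2l sum_bcw_offset.
rewrite Num.Theory.ler_pdivrMr ?Num.Theory.ltr0n //.
rewrite -!GRing.mulrA [(2%:R^-1 * _)%R]GRing.mulrC !GRing.mulrA.
rewrite Num.Theory.ler_pdivlMr ?Num.Theory.ltr0n //.
by rewrite -!GRing.natrM Num.Theory.ler_nat mulnC.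
Qed.
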